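(* Let $(\xi^{(n)})_n$ be a sequence of Ramanujan graphs, $\xi^{(n)}$ being a $d_n$-regular Ramanujan graph on $n$ vertices (identified with its adjacency matrix), and let $p_n$ be defined by $d_n=np_n$. Suppose that $\lim_{n\to\infty}d_n=\infty$. Then $$\lim_{n\to\infty}\ \sup_{s_i,t_j\in\{-1,1\}}\ \frac1{n^2}\sum_{i,j=1}^n\Big(\frac{\xi^{(n)}_{ij}}{p_n}-1\Big)s_it_j=0.$$
   Context: For $d\ge2$, a $d$-regular graph is a graph in which each vertex has exactly $d$ neighbors. A Ramanujan graph is a $d$-regular graph such that $\lambda(d)\le2\sqrt{d-1}$, where $\lambda(d)$ is the second biggest eigenvalue in absolute value of the adjacency matrix, i.e. if the eigenvalues (with multiplicity) are $d=\lambda_1\ge\lambda_2\ge\dots\ge\lambda_n$ then $\lambda(d)=\max(|\lambda_2|,|\lambda_n|)$. The supremum is over all $(s_1,\dots,s_n),(t_1,\dots,t_n)\in\{-1,1\}^n$. *)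

(* Defs.v *)
From HB Require Import structures.
From mathcomp Require Import all_boot all_order all_algebra.
From mathcomp Require Import polyrcf.
From mathcomp Require Import all_classical all_reals all_analysis.

Set Implicit Arguments.
Unset Strict Implicit.
Unset Printing Implicit Defensive.

Import Order.TTheory GRing.Theory Num.Theory.
Local Open Scope ring_scope.

Definition simple_graph (n : nat) (e : rel 'I_n) : Prop :=
  symmetric e /\ irreflexive e.

Definition regular_graph (n d : nat) (e : rel 'I_n) : Prop :=
  [/\ simple_graph e, (2 <= d)%N & forall i : 'I_n, #|[set j | e i j]| = d].

Definition adjacency_mx (R : realType) (n : nat) (e : rel 'I_n) : 'M[R]_n :=
  \matrix_(i, j) (e i j)%:R.

(* The real eigenvalues of A in nonincreasing order, each repeated according to
   its multiplicity as a root of the characteristic polynomial. [rootsR] lists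
   each real root once. For symmetric A this list has length n. *)
Definition eigenvalues (R : realType) (n : nat) (A : 'M[R]_n) : seq R :=
  sort >=%R (flatten [seq nseq (mup x (char_poly A)) x
                     | x <- rootsR (char_poly A)]).

(* max(|lambda_2|, |lambda_n|); lambda_2 is at position 1, as lists are
   indexed from 0. *)
Definition second_eigenvalue (R : realType) (n : nat) (A : 'M[R]_n) : R :=
  let l := eigenvalues A in Num.max `|nth 0 l 1| `|last 0 l|.

Definition ramanujan (R : realType) (n d : nat) (e : rel 'I_n) : Prop :=
  regular_graph d e /\
  second_eigenvalue (adjacency_mx R e) <= 2 * Num.sqrt (d%:R - 1).

Definition sign_vector (R : realType) (n : nat) (s : 'I_n -> R) : Prop :=
  forall i, s i = -1 \/ s i = 1.

(* Main.v *)
Require Import Defs.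
From HB Require Import structures.
From mathcomp Require Import all_boot all_order all_algebra.
From mathcomp Require Import complex polyrcf.
From mathcomp Require Import all_classical all_reals all_analysis.
From mathcomp Require Import ring.

(** Let A be the adjacency matrix, J the matrix with all entries p = d/n and
    B = A - J. Since B J = 0, one has char_poly B * char_poly J =
    'X^n * char_poly A; as d is a root of char_poly J, every nonzero root a of
    char_poly B satisfies ('X - d) ('X - a) %| char_poly A, hence
    |a| <= max(|lambda_2|, |lambda_n|) <= 2 sqrt(d - 1). By the spectral theorem
    |s B t^T| <= 2 sqrt(d - 1) n for sign vectors s and t, and after division by
    n^2 p = n d this is at most 2 / sqrt d. *)

Import Order.TTheory GRing.Theory Num.Theory.
Import numFieldNormedType.Exports.
Local Open Scope classical_set_scope.
Local Open Scope ring_scope.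

(** Expanding, ('X - B)('X - J) = 'X ('X - (B + J)) because the term B J vanishes; then take
    determinants. *)
Lemma char_poly_mul_annihilating (K : comNzRingType) (n : nat) (B J : 'M[K]_n) :
  B *m J = 0 -> char_poly B * char_poly J = 'X^n * char_poly (B + J).
Proof.
move=> BJ0; rewrite /char_poly -det_mulmx -detZ; congr (\det _).
rewrite /char_poly_mx mulmxBl !mulmxBr -map_mxM BJ0 map_mx0 subr0 map_mxD.
rewrite scalerBr scalerDr scale_scalar_mx -scalar_mxM mul_scalar_mx.
by rewrite mul_mx_scalar opprD [- _ - _]addrC addrA.
Qed.

(** * Bilinear forms of Hermitian and real symmetric matrices *)

Section Spectral.
Local Open Scope sesquilinear_scope.

Lemma unitary_norm (C : numClosedFieldType) (n : nat) (P : 'M[C]_n)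
    (u : 'rV[C]_n) :
  P \is unitarymx -> \sum_i `|(u *m P^t*) 0 i| ^+ 2 = \sum_i `|u 0 i| ^+ 2.
Proof.
move=> PU.
have sumE (w : 'rV[C]_n) : \sum_i `|w 0 i| ^+ 2 = (w *m w^t*) 0 0.
  by rewrite mxE; apply: eq_bigr => i _; rewrite !mxE normCK.
by rewrite !sumE trmx_mul map_mxM trmxCK mulmxA mulmxKtV.
Qed.

(** In a unitary eigenbasis the form is a sum of D_i x_i y_i^*, and |x_i| |y_i| is at most (|x_i|^2
    + |y_i|^2) / 2. Real roots suffice because the spectrum of a Hermitian matrix is real. *)
Lemma hermitian_sesquilinear_bound (C : numClosedFieldType) (n : nat)
    (A : 'M[C]_n) (l : C) (u v : 'rV[C]_n) :
    A \is hermsymmx ->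
    (forall a, a \is Num.real -> root (char_poly A) a -> `|a| <= l) ->
  `|(u *m A *m v^t*) 0 0|
    <= l * ((\sum_i `|u 0 i| ^+ 2 + \sum_i `|v 0 i| ^+ 2) / 2).
Proof.
move=> Aherm Al; have Dr := hermitian_spectral_diag_real Aherm.
have /orthomx_spectralP AE := hermitian_normalmx Aherm.
have PU := spectral_unitarymx A; have Punit := unitarymx_unit PU.
move: (spectralmx A) (spectral_diag A) => P D in AE Dr PU Punit *.
have Dl i : `|D 0 i| <= l.
  apply: Al; first exact: (mxOverP Dr).
  (* The rows of [P] are eigenvectors, nonzero because [P *m P^t*] has diagonal entries 1. *)
  rewrite -eigenvalue_root_char; apply/eigenvalueP; exists (row i P).
    rewrite AE -row_mul 2!mulmxA mulmxV // mul1mx row_mul row_diag_mx.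
    by rewrite -scalemxAl -rowE.
  apply/eqP => Pi0; have /rowP/(_ i) : row i (P *m P^t*) = 0.
    by rewrite row_mul Pi0 mul0mx.
  by rewrite (unitarymxP PU) !mxE eqxx => /eqP; rewrite oner_eq0.
rewrite -(unitary_norm _ _ _ u PU) -(unitary_norm _ _ _ v PU).
have vE : P *m v^t* = (v *m P^t*)^t* by rewrite trmx_mul map_mxM trmxCK.
rewrite AE invmx_unitary // !mulmxA -[_ *m P *m _]mulmxA vE mul_mx_diag.
move: (u *m P^t*) (v *m P^t*) => x y.
rewrite mxE (le_trans (ler_norm_sum _ _ _)) //.
rewrite -big_split /= mulr_suml mulr_sumr.
apply: ler_sum => i _; rewrite !mxE !normrM norm_conjC mulrAC mulrC.
apply: ler_pM => //.
rewrite ler_pdivlMr // -subr_ge0.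
have -> : `|x 0 i| ^+ 2 + `|y 0 i| ^+ 2 - `|x 0 i| * `|y 0 i| * 2 =
  (`|x 0 i| - `|y 0 i|) ^+ 2 by ring.
by rewrite real_exprn_even_ge0 // realB // normr_real.
Qed.

(** Over [R[i]] the matrix becomes Hermitian, and the real roots of its characteristic polynomial
    are those over [R]. *)
Lemma symmetric_bilinear_bound (R : rcfType) (n : nat) (B : 'M[R]_n) (l : R)
    (s t : 'I_n -> R) :
    B^T = B -> (forall a, root (char_poly B) a -> `|a| <= l) ->
  `|\sum_i \sum_j B i j * s i * t j|
    <= l * ((\sum_i s i ^+ 2 + \sum_i t i ^+ 2) / 2).
Proof.
move=> Bsym Bl.
pose f : {rmorphism R -> R[i]%C} := real_complex R.
have fconj x : (f x)^* = f x by apply: conjc_real.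
have freal x : f x \is Num.real by apply/complex_realP; exists x.
have fnorm x : `|f x| = f `|x| by rewrite normc_def /= expr0n addr0 sqrtr_sqr.
have fle x y : (f x <= f y) = (x <= y) by apply: lecR.
have : map_mx f B \is hermsymmx.
  apply: realsym_hermsym.
    by apply/is_hermitianmxP; rewrite expr0 scale1r map_mx_id // map_trmx Bsym.
  by apply/mxOverP => i j; rewrite mxE.
move=> Bherm.
have := hermitian_sesquilinear_bound _ _ _ (f l)
  (\row_i f (s i)) (\row_i f (t i)) Bherm.
have -> : (\row_i f (s i) *m map_mx f B *m (\row_i f (t i))^t*) 0 0 =
    f (\sum_i \sum_j B i j * s i * t j).
  rewrite exchange_big rmorph_sum [LHS]mxE /=; apply: eq_bigr => j _.
  rewrite rmorph_sum !mxE mulr_suml; apply: eq_bigr => i _.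
  by rewrite !mxE !rmorphM fconj /= [f (s i) * _]mulrC.
have sqE (w : 'I_n -> R) :
    \sum_i `|(\row_i f (w i)) 0 i| ^+ 2 = f (\sum_i w i ^+ 2).
  rewrite rmorph_sum; apply: eq_bigr => i _.
  by rewrite mxE rmorphXn; apply: real_normK.
rewrite !sqE -[X in _ / X](rmorph_nat f) -rmorphD -fmorph_div -rmorphM.
rewrite fnorm fle.
apply=> a /complex_realP[k ->]; rewrite -map_char_poly fmorph_root => /Bl.
by rewrite fnorm fle.
Qed.
End Spectral.

(** * The sorted list of eigenvalues and its second and last entries *)

Lemma count_eigenvalues (R : realType) (n : nat) (A : 'M[R]_n) (a : R) :
  count_mem a (eigenvalues A) = mup a (char_poly A).
Proof.
rewrite count_sort count_flatten -map_comp sumnE big_map.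
have A0 : char_poly A != 0 by rewrite monic_neq0 ?char_poly_monic.
under eq_bigr do rewrite /= count_nseq.
have := roots_on_rootsR A0 a; rewrite in_itv /=.
case: (boolP (root _ a)) => [_ /esym aroots|aNroot /esym aroots]; last first.
  rewrite (mupNroot aNroot) big1_seq // => x /andP[_ xroots].
  by rewrite /= (negbTE (memPn (negbT aroots) x xroots)).
rewrite (bigD1_seq a) ?uniq_roots //= eqxx mul1n big1 ?addn0 // => x.
by move=> /negbTE ->.
Qed.

Lemma path_ge_last (R : realType) (l : seq R) (a b : R) :
  path >=%R a l -> b \in a :: l -> last a l <= b.
Proof.
elim: l a b => [|z l IHl] a b /=; first by rewrite mem_seq1 => _ /eqP->.
move=> /andP[za zl]; rewrite inE => /predU1P[->|]; last exact: IHl.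
by rewrite (le_trans _ za) ?IHl ?mem_head.
Qed.

(** The boolean [a == b], read as 0 or 1, asks for two occurrences of [b] when the values coincide.
    So [a] and [b] fill two distinct positions, and the smaller one can be placed after the head. *)
Lemma sorted_nth1_last_bounds (R : realType) (l : seq R) (a b : R) :
    sorted >=%R l -> b <= a ->
    (0 < count_mem a l)%N -> ((a == b) < count_mem b l)%N ->
  last 0 l <= b <= nth 0 l 1.
Proof.
case: l => [//|x l] /= xl ba a_l b_l.
have ge_trans : transitive (>=%R : rel R).
  by move=> ? ? ? /[swap]; exact: le_trans.
move: (xl); rewrite (path_sortedE ge_trans) => /andP[/allP xmax lsorted].
(* If the head is [b] and [a] differs from [b], then [a] lies in the tail and exceeds the head,
   against the order. *)
have bl : b \in l.
  rewrite -has_pred1 has_count; case: (eqVneq x b) b_l => [xb|_]; last first.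
    exact: leq_trans.
  case: (eqVneq a b) => [_|ab _]; first by rewrite add1n ltnS.
  have : a \in l.
    by rewrite -has_pred1 has_count; move: a_l; rewrite xb eq_sym (negbTE ab).
  by move=> /xmax /=; rewrite xb leNgt lt_neqAle ba eq_sym ab.
case: l lsorted bl {xl xmax a_l b_l} => [//|y l] /= yl bl.
rewrite path_ge_last //=; move: bl; rewrite inE => /predU1P[->//|bl].
by move: yl; rewrite (path_sortedE ge_trans) => /andP[/allP/(_ b bl)].
Qed.

Lemma second_eigenvalue_ge (R : realType) (n : nat) (A : 'M[R]_n) (a b : R) :
  b <= a -> ('X - a%:P) * ('X - b%:P) %| char_poly A ->
  `|b| <= second_eigenvalue A.
Proof.
move=> ba abA.
have A0 : char_poly A != 0 by rewrite monic_neq0 ?char_poly_monic.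
have /andP[lo hi] : last 0 (eigenvalues A) <= b <= nth 0 (eigenvalues A) 1.
  apply: (@sorted_nth1_last_bounds _ _ a) => //.
  - by apply: sort_sorted => x y; exact: le_total.
  - by rewrite count_eigenvalues mup_geq // expr1 (dvdp_trans _ abA) ?dvdp_mulr.
  (* For [a = b] the divisor is a square, which gives multiplicity at least 2. *)
  rewrite count_eigenvalues mup_geq //; case: eqVneq abA => [->//|_].
  by apply: dvdp_trans; rewrite expr1 dvdp_mull.
(* A nonnegative [b] is controlled by lambda_2, a negative one by lambda_n. *)
rewrite le_max; case: (leP 0 b) => b0.
  by rewrite (ger0_norm b0) (le_trans hi) ?ler_norm.
rewrite (ltr0_norm b0) orbC -[`|last _ _|]normrN.
by rewrite (le_trans _ (ler_norm _)) ?lerN2.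
Qed.

Lemma second_eigenvalue_ge0 (R : realType) (n : nat) (A : 'M[R]_n) :
  0 <= second_eigenvalue A.
Proof. by rewrite le_max normr_ge0. Qed.

(** * Spectrum of a regular graph before and after deflation *)

Lemma adjacency_row_sum (R : realType) (n d : nat) (e : rel 'I_n) (i : 'I_n) :
  regular_graph d e -> \sum_j adjacency_mx R e i j = d%:R.
Proof.
move=> [_ _ /(_ i) <-]; rewrite -sum1_card natr_sum.
rewrite [RHS]big_mkcond /=; apply: eq_bigr => j _.
by rewrite !mxE inE; case: (e i j).
Qed.

Lemma adjacency_sym (R : realType) (n : nat) (e : rel 'I_n) :
  symmetric e -> (adjacency_mx R e)^T = adjacency_mx R e.
Proof. by move=> esym; apply/matrixP => i j; rewrite !mxE esym. Qed.

(** Evaluate the eigenvector equation at a coordinate of largest modulus. This shows that d is the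
    top eigenvalue, so that any other root can play the smaller one in [second_eigenvalue_ge]. *)
Lemma adjacency_eigenvalue_le (R : realType) (n d : nat) (e : rel 'I_n) (a : R) :
    regular_graph d e -> root (char_poly (adjacency_mx R e)) a ->
  `|a| <= d%:R.
Proof.
move=> e_reg; set A := adjacency_mx R e; have [[esym _] _ _] := e_reg.
rewrite -eigenvalue_root_char => /eigenvalueP[v vA /rV0Pn[k vk]].
have [i _ imax] := @arg_maxP _ _ _ k xpredT (fun i => `|v 0 i|) isT.
have vi : 0 < `|v 0 i| by rewrite (lt_le_trans _ (imax k isT)) ?normr_gt0.
rewrite -(ler_pM2r vi) -normrM.
have /rowP/(_ i) := vA; rewrite !mxE => <-.
rewrite -(adjacency_row_sum R _ _ _ i e_reg) mulr_suml.
rewrite (le_trans (ler_norm_sum _ _ _)) //.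
apply: ler_sum => j _; rewrite normrM mulrC.
(* Eigenvectors are row vectors, so column entries appear; symmetry turns them into row entries,
   which sum to d. *)
rewrite /A -(adjacency_sym _ _ _ esym) mxE (adjacency_sym _ _ _ esym).
have A0 : 0 <= A i j by rewrite mxE.
by rewrite ger0_norm // ler_wpM2l //; exact: imax.
Qed.

Lemma deflated_eigenvalue_le (R : realType) (n d : nat) (e : rel 'I_n) (a : R) :
    regular_graph d e ->
    root (char_poly (adjacency_mx R e - const_mx (d%:R / n%:R))) a ->
  `|a| <= second_eigenvalue (adjacency_mx R e).
Proof.
set A := adjacency_mx R e; set J := const_mx _ => e_reg aB.
have [->|a0] := eqVneq a 0; first by rewrite normr0 second_eigenvalue_ge0.
have /eigenvalueP[_ _ /rV0Pn[i0 _]] : eigenvalue (A - J) a.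
  by rewrite eigenvalue_root_char.
have n0 : n%:R != 0 :> R by rewrite pnatr_eq0 -lt0n (leq_trans _ (ltn_ord i0)).
have d0 : d%:R != 0 :> R by case: e_reg => _ d2 _; rewrite pnatr_eq0 -lt0n ltnW.
(* Each row of [A - J] sums to d - n (d / n) = 0. *)
have BJ0 : (A - J) *m J = 0.
  apply/matrixP => i j; rewrite !mxE; under eq_bigr do rewrite !mxE.
  rewrite -mulr_suml sumrB sumr_const card_ord -[(_ / _) *+ n]mulr_natr divfK //.
  have := adjacency_row_sum R _ _ _ i e_reg; under eq_bigr do rewrite mxE.
  by move=> ->; rewrite subrr mul0r.
(* The all-ones vector is an eigenvector of [J] for d. *)
have dJ : root (char_poly J) d%:R.
  rewrite -eigenvalue_root_char; apply/eigenvalueP; exists (const_mx 1).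
    apply/rowP => j; rewrite !mxE; under eq_bigr do rewrite !mxE mul1r.
    by rewrite sumr_const card_ord -[(_ / _) *+ n]mulr_natr divfK ?mulr1.
  by apply/rV0Pn; exists i0; rewrite mxE oner_neq0.
have daA : ('X - d%:R%:P) * ('X - a%:P) %| char_poly A.
  have : ('X - d%:R%:P) * ('X - a%:P) %| 'X^n * char_poly A.
    rewrite -[in char_poly A](subrK J A) -char_poly_mul_annihilating // mulrC.
    by rewrite dvdp_mul // dvdp_XsubCl.
  rewrite Gauss_dvdpr // coprimep_expr // coprimepMl.
  by rewrite ![coprimep _ 'X]coprimep_sym !coprimep_XsubC !rootX d0 a0.
apply: (second_eigenvalue_ge _ _ _ _ _ _ daA).
apply: le_trans (ler_norm _) _; apply: (adjacency_eigenvalue_le _ _ _ _ _ e_reg).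
by rewrite -dvdp_XsubCl (dvdp_trans _ daA) ?dvdp_mull.
Qed.

(** * From the spectral bound to the supremum and its limit *)

Lemma sup_norm_le (R : realType) (E : set R) (c : R) :
  E !=set0 -> (forall x, E x -> `|x| <= c) -> `|sup E| <= c.
Proof.
move=> [x Ex] Ec; rewrite ler_norml; apply/andP; split.
  apply: le_trans (_ : x <= _); first by have := Ec x Ex; rewrite ler_norml => /andP[].
  by apply: ub_le_sup => //; exists c => y /Ec; exact: le_trans (ler_norm _).
by apply: ge_sup; [exists x | move=> y /Ec; exact: le_trans (ler_norm _)].
Qed.

Lemma ramanujan_discrepancy (R : realType) (n d : nat) (e : rel 'I_n) (p : R)
    (s t : 'I_n -> R) :
    (0 < n)%N -> ramanujan R d e -> d%:R = n%:R * p ->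
    sign_vector s -> sign_vector t ->
  `|(n%:R ^+ 2)^-1 * \sum_(i < n) \sum_(j < n)
      (adjacency_mx R e i j / p - 1) * s i * t j| <= 2 / Num.sqrt d%:R.
Proof.
move=> n_gt0 [e_reg l2] dE s1 t1; have [[esym _] d2 _] := e_reg.
have n0 : 0 < n%:R :> R by rewrite ltr0n.
have d0 : 0 < d%:R :> R by rewrite ltr0n (leq_trans _ d2).
have pE : p = d%:R / n%:R by rewrite dE mulrAC divff ?mul1r // gt_eqF.
have p0 : p != 0 by rewrite pE gt_eqF // divr_gt0.
set A := adjacency_mx R e in l2 *; pose B := A - const_mx p.
(* Both squared norms equal n, so their arithmetic mean is n as well. *)
have sq (w : 'I_n -> R) : sign_vector w -> \sum_i w i ^+ 2 = n%:R.
  move=> w1; rewrite (eq_bigr (fun=> 1)) ?sumr_const ?card_ord // => i _.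
  by case: (w1 i) => ->; rewrite ?sqrrN expr1n.
have Bsym : B^T = B.
  by rewrite /B linearB /= trmx_const (adjacency_sym _ _ _ esym).
have := @symmetric_bilinear_bound _ _ B (2 * Num.sqrt (d%:R - 1)) s t Bsym.
rewrite !sq // => Bst.
(* The entries of A / p - 1 are those of B / p, and n^2 p = n d. *)
have -> : (n%:R ^+ 2)^-1 * (\sum_i \sum_j (A i j / p - 1) * s i * t j) =
    (n%:R * d%:R)^-1 * \sum_i \sum_j B i j * s i * t j.
  rewrite !mulr_sumr; apply: eq_bigr => i _; rewrite !mulr_sumr.
  apply: eq_bigr => j _; rewrite !mxE dE; field.
  by rewrite p0 gt_eqF.
have nd0 : 0 < n%:R * d%:R :> R by rewrite mulr_gt0.
rewrite normrM gtr0_norm ?invr_gt0 // mulrC ler_pdivrMr //.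
apply: le_trans (Bst _) _.
  move=> a; rewrite /B pE.
  by move=> /(deflated_eigenvalue_le _ _ _ _ _ e_reg)/le_trans; apply.
(* With d = r^2 the target becomes 2 r n, and sqrt(d - 1) is at most r. *)
rewrite -[X in _ <= _ * (_ * X)]sqr_sqrtr ?(ltW d0) //.
set r := Num.sqrt d%:R; have r0 : 0 < r by rewrite sqrtr_gt0.
have -> : 2 / r * (n%:R * r ^+ 2) = 2 * r * ((n%:R + n%:R) / 2).
  by field; rewrite gt_eqF.
rewrite ler_wpM2r ?divr_ge0 ?addr_ge0 ?(ltW n0) //.
by rewrite ler_wpM2l // ler_wsqrtr // gerBl.
Qed.

Theorem propositionA6 (R : realType) (n0 : nat) (d : nat -> nat) (p : nat -> R)
    (xi : forall n : nat, rel 'I_n)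
    (xi_ramanujan : forall n : nat, (n0 <= n)%N -> ramanujan R (d n) (xi n))
    (dE : forall n : nat, (n0 <= n)%N -> (d n)%:R = n%:R * p n)
    (d_infty : d n @[n --> \oo] --> \oo) :
  sup [set x : R | exists s t : 'I_n -> R,
         [/\ sign_vector s, sign_vector t &
             x = (n%:R ^+ 2)^-1 *
                 \sum_(i < n) \sum_(j < n)
                   (adjacency_mx R (xi n) i j / p n - 1) * s i * t j]]
    @[n --> \oo] --> (0 : R).
Proof.
apply/cvgr0Pnorm_le => eps eps0.
(* Once d exceeds (2 / eps)^2, the bound 2 / sqrt d is below eps. *)
have [M ltM] : exists M : nat, (2 / eps) ^+ 2 < M%:R.
  exists (Num.truncn ((2 / eps) ^+ 2)).+1; exact: truncnS_gt.
have /cvgnyPge/(_ M) d_ge := d_infty.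
near=> n.
have n_gt0 : (0 < n)%N by near: n; exact: nbhs_infty_gt.
have n0n : (n0 <= n)%N by near: n; exact: nbhs_infty_ge.
have Md : (M <= d n)%N by near: n.
apply: (@le_trans _ _ (2 / Num.sqrt (d n)%:R)); last first.
  have ltd : (2 / eps) ^+ 2 < (d n)%:R by rewrite (lt_le_trans ltM) // ler_nat.
  have r0 : 0 < Num.sqrt (d n)%:R :> R.
    by rewrite sqrtr_gt0 (le_lt_trans _ ltd) // sqr_ge0.
  rewrite ler_pdivrMr // mulrC -ler_pdivrMr //.
  rewrite -[2 / eps]ger0_norm -?sqrtr_sqr; last by rewrite divr_ge0 // ltW.
  by rewrite ler_wsqrtr // ltW.
apply: sup_norm_le.
  (* The constant sign vectors show that the set is nonempty. *)
  eexists; exists (fun=> 1), (fun=> 1); split; last reflexivity; by move=> ?; right.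
move=> _ [s [t [s1 t1 ->]]].
exact: ramanujan_discrepancy (xi_ramanujan n n0n) (dE n n0n) s1 t1.
Unshelve. all: by end_near.
Qed.
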